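(* (Unfurling algorithm.) Let $G$ be a finite connected loopless undirected multigraph. Input: a partial orientation $\mathcal{O}$ of $G$ containing a directed cycle and a source. Procedure: at each step, run the oriented Dhar's algorithm (described in the context) on the current partial orientation, starting from $X$ equal to its set of sources. If it ends with $X=V(G)$, stop and output the current partial orientation. Otherwise, reverse the consistently oriented cut $(X,X^c)$ given by the oriented Dhar's algorithm, reset $X$ to be the set of sources, and go to the next step. (If the current partial orientation has no sources, stop and output it.) This procedure terminates, and its output is a partial orientation $\mathcal{O}'$, equivalent to $\mathcal{O}$ in the generalized cocycle reversal system, which is either acyclic or sourceless.
   Context: A partial orientation of $G$ is a choice of direction for each edge in some subset of $E(G)$; the remaining edges are unoriented. It is acyclic if it contains no directed cycle; a source is a vertex with no incoming oriented edge; it is sourceless if it has no sources. For $X\subset V(G)$, $(X,X^c)$ is the set of edges with one end in $X$ and the other in $X^c$, $G[X]$ is the induced subgraph, and the boundary of $X$ is the set of vertices of $X$ incident to an edge of $(X,X^c)$. A cut is consistently oriented if all its edges are oriented, and in the same direction across the cut. Moves. Edge pivot at $v$: an edge oriented towards $v$ becomes unoriented and an unoriented edge incident to $v$ becomes oriented towards $v$. Cocycle (cut) reversal: reverse all edges of a consistently oriented cut. Two partial orientations are equivalent in the generalized cocycle reversal system if they are related by a finite sequence of edge pivots and cocycle reversals. Oriented Dhar's algorithm, applied to a partial orientation: initialize $X$ as the set of sources. At the beginning of each step, look at the cut $(X,X^c)$ and perform any available edge pivots at vertices on the boundary of $X^c$ which bring oriented edges into the cut directed towards $X^c$ (i.e.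 an edge inside $G[X^c]$ oriented towards $v$ is unoriented and an unoriented edge of the cut incident to $v$ is oriented towards $v\in X^c$). Afterwards, add to $X$ each $v$ on the boundary of $X^c$ with no incoming edge contained in $G[X^c]$. If no such vertex exists, stop. When it stops with $X\ne V(G)$, the cut $(X,X^c)$ is consistently oriented towards $X^c$. *)

(* Defs.v *)
From mathcomp Require Import all_boot.
From Stdlib Require Import Relation_Operators.

Set Implicit Arguments.
Unset Strict Implicit.
Unset Printing Implicit Defensive.

(* The two ends of an edge are indexed by bool; this labelling is only a
   reference for describing orientations and has no mathematical meaning. *)
Record multigraph := Multigraph {
  vertex : finType;
  edge : finType;
  endpt : edge -> bool -> vertex;
  loopless : forall e, endpt e false != endpt e true
}.

(* O e = Some b : e is directed from endpt e (~~ b) to endpt e b;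
   O e = None   : e is unoriented. *)
Definition orientation (G : multigraph) := {ffun edge G -> option bool}.

Section Unfurling.
Variable G : multigraph.
Implicit Types (O : orientation G) (X : {set vertex G}).
Implicit Types (u v : vertex G) (e f : edge G).

Definition incident e v : bool := [exists b, endpt e b == v].

Definition adjacent : rel (vertex G) :=
  fun u v => [exists e, exists b, (endpt e b == u) && (endpt e (~~ b) == v)].

Definition connected : Prop := forall u v, connect adjacent u v.

Definition head O e : option (vertex G) := omap (endpt e) (O e).
Definition tail O e : option (vertex G) :=
  omap (fun b => endpt e (~~ b)) (O e).

Definition arc O : rel (vertex G) :=
  fun u v => [exists e, (tail O e == Some u) && (head O e == Some v)].

(* Two parallel edges directed oppositely give a cycle [:: u; v]; cycles of
   length one are excluded by looplessness. *)
Definition has_dicycle O : Prop :=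
  exists c : seq (vertex G), c <> [::] /\ ucycle (arc O) c.

Definition acyclic O : Prop := ~ has_dicycle O.

Definition sources O : {set vertex G} :=
  [set v | [forall e, head O e != Some v]].

Definition sourceless O : Prop := sources O = set0.

Definition cut X : {set edge G} :=
  [set e | (endpt e false \in X) != (endpt e true \in X)].

(* The edges of the induced subgraph G[X]. *)
Definition inner X : {set edge G} := [set e | [forall b, endpt e b \in X]].

Definition boundary X : {set vertex G} :=
  [set v in X | [exists e in cut X, incident e v]].

Definition cut_directed_out O X : Prop :=
  forall e, e \in cut X -> exists2 v, v \in ~: X & head O e = Some v.

Definition consistently_oriented O X : Prop :=
  cut_directed_out O X \/ cut_directed_out O (~: X).

(* e becomes unoriented and f, an edge incident to v, is directed towards v;
   by looplessness [endpt f (endpt f true == v)] is v. *)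
Definition pivot O v e f : orientation G :=
  [ffun g => if g == e then None
             else if g == f then Some (endpt f true == v) else O g].

Definition can_pivot O v e f : Prop :=
  [/\ head O e = Some v, O f = None & incident f v].

Definition reverse_cut O X : orientation G :=
  [ffun e => if e \in cut X then omap negb (O e) else O e].

Inductive move O : orientation G -> Prop :=
| MovePivot v e f : can_pivot O v e f -> move O (pivot O v e f)
| MoveReversal X : consistently_oriented O X -> move O (reverse_cut O X).

(* Moves are invertible by moves, so no symmetric closure is needed. *)
Definition equivalent : orientation G -> orientation G -> Prop :=
  clos_refl_trans (orientation G) move.

Definition dhar_can_pivot O X v e f : Prop :=
  [/\ can_pivot O v e f, v \in boundary (~: X), e \in inner (~: X)
    & f \in cut X].

Definition dhar_pivots_done O X : Prop :=
  forall v e f, ~ dhar_can_pivot O X v e f.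

Definition dhar_new O X : {set vertex G} :=
  [set v in boundary (~: X) | [forall e in inner (~: X), head O e != Some v]].

(* [Outer O]: beginning of a step of the unfurling procedure.
   [Dhar O X]: oriented Dhar's algorithm in progress. *)
Inductive state :=
| Outer of orientation G
| Dhar of orientation G & {set vertex G}
| Output of orientation G.

(* The relation is nondeterministic: available pivots may be performed in any
   order and with any choice of edges, but all of them are exhausted before
   vertices are added to X. *)
Inductive step : state -> state -> Prop :=
| StepSourceless O :
    sourceless O -> step (Outer O) (Output O)
| StepInit O :
    ~ sourceless O -> step (Outer O) (Dhar O (sources O))
| StepPivot O X v e f :
    dhar_can_pivot O X v e f -> step (Dhar O X) (Dhar (pivot O v e f) X)
| StepAdd O X :
    dhar_pivots_done O X -> dhar_new O X <> set0 ->
    step (Dhar O X) (Dhar O (X :|: dhar_new O X))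
| StepFull O X :
    dhar_pivots_done O X -> dhar_new O X = set0 -> X = setT ->
    step (Dhar O X) (Output O)
| StepReverse O X :
    dhar_pivots_done O X -> dhar_new O X = set0 -> X <> setT ->
    cut_directed_out O X -> step (Dhar O X) (Outer (reverse_cut O X)).

Definition reachable : state -> state -> Prop := clos_refl_trans state step.

Definition final (s : state) : Prop := forall t, ~ step s t.

(* Every run from s is finite. *)
Definition terminates (s : state) : Prop := Acc (fun t s => step s t) s.

End Unfurling.

Arguments Outer {G}.
Arguments Dhar {G}.
Arguments Output {G}.

(* Main.v *)
From mathcomp Require Import all_boot zify.
From Stdlib Require Import Relation_Operators.
Require Import Defs.

Set Implicit Arguments.
Unset Strict Implicit.
Unset Printing Implicit Defensive.

(** Every vertex added by Dhar's algorithm has all its incoming edges coming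
    from the vertices burnt before it, so the burnt part is acyclic, and no edge
    ever enters it; hence the output is acyclic when everything burns, and
    otherwise the final cut is consistently oriented.

    For termination, weight an oriented edge by a function of its head.  Pivots
    preserve the total weight, and a reversal never creates a source.  As long
    as the set of sources does not change, fix a source [s] and let the weight
    of a vertex decrease geometrically with its distance to [s].  A reversed cut
    [(X, X^c)] has [s] in [X], and one of its edges joins [X] to a vertex of
    [X^c] closest to [s]; moving the head of that edge into [X] outweighs the
    changes on all other edges, so the bounded total weight strictly increases. *)

(** * Weights that decay geometrically with the distance to a fixed vertex *)

Section Potential.
Variable V : finType.
Variable adj : rel V.

Lemma connect_search_rank (s : V) :
  (forall v, connect adj s v) ->
  exists r : V -> nat, forall v, v != s -> exists2 u, adj u v & r u < r v.
Proof.
move=> conn.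
(* Quantifying over [n.-tuple V], a finite type, makes [P v] decidable, so that [ex_minn] can pick
   the distance from [s] as the rank. *)
pose P v n := [exists p : n.-tuple V, path adj s p && (last s p == v)].
have exP v : exists n, P v n.
  have /connectP[p pp ->] := conn v.
  by exists (size p); apply/existsP; exists (in_tuple p); rewrite pp eqxx.
exists (fun v => ex_minn (exP v)) => v vs.
case: (ex_minnP (exP v)) => n /existsP[[p /= /eqP sp] /andP[pp /eqP lp]] _.
case/lastP: p => [|p w] in sp pp lp *; first by rewrite -lp eqxx in vs.
rewrite last_rcons in lp; subst w.
move: pp; rewrite rcons_path => /andP[pp lpv]; exists (last s p) => //.
case: (ex_minnP (exP (last s p))) => m _ /(_ (size p)) m_le.
rewrite -sp size_rcons ltnS; apply: m_le.
by apply/existsP; exists (in_tuple p); rewrite pp eqxx.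
Qed.

(** Take [y] in [Y] nearest to [s] and [u] its predecessor on a shortest path. Every [z] in [Y] is
    then strictly farther from [s] than [u], so its weight is smaller by a factor of at least
    [k.+1]. *)
Lemma connect_dominating_weight (s : V) (k : nat) :
  (forall v, connect adj s v) ->
  exists w : V -> nat, forall Y : {set V}, Y != set0 -> s \notin Y ->
    exists u y, [/\ u \notin Y, y \in Y, adj u y &
                 forall z, z \in Y -> k * w z < w u].
Proof.
move=> /connect_search_rank[r rP].
pose N := \max_v r v; pose w v := k.+1 ^ (N - r v); exists w => Y /set0Pn[y0 Yy0] sY.
case: (arg_minnP r Yy0) => y Yy y_min.
have [u uy ltuy] : exists2 u, adj u y & r u < r y.
  by apply: rP; apply: contraNneq sY => <-.
exists u, y; split=> // [|z /y_min le_yz].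
  by apply/negP => /y_min; rewrite leqNgt ltuy.
have le_w : w z <= k.+1 ^ (N - r u).-1.
  have lt_uz := leq_trans ltuy le_yz.
  by rewrite leq_pexp2l //; lia.
have leN v : r v <= N by exact: leq_bigmax.
(* The exponent [N - r u] is positive because [r u < r y <= N], so one factor [k.+1] can be split
   off. *)
have -> : w u = k.+1 * k.+1 ^ (N - r u).-1.
  by rewrite -expnS /w prednK // subn_gt0; apply: leq_trans ltuy (leN y).
apply: leq_ltn_trans (leq_mul (leqnn k) le_w) _.
by rewrite ltn_mul2r expn_gt0 /= ltnSn.
Qed.

End Potential.

Section Unfurling.
Variable G : multigraph.
Implicit Types (O : orientation G) (X : {set vertex G}).
Implicit Types (u v : vertex G) (e f : edge G).

(** * Heads and tails under pivots and cut reversals *)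

Lemma incident_pivot_endpt v f :
  incident f v -> endpt f (endpt f true == v) = v.
Proof.
case: eqP => // ne /existsP[[] /eqP fv] //.
Qed.

Lemma head_pivot O v e f g : can_pivot O v e f ->
  head (pivot O v e f) g =
    if g == e then None else if g == f then Some v else head O g.
Proof.
case=> _ _ fv; rewrite /head /pivot ffunE.
by case: eqP => // _; case: eqP => // -> /=; rewrite incident_pivot_endpt.
Qed.

Lemma tail_pivot O v e f g : g != f ->
  tail (pivot O v e f) g = if g == e then None else tail O g.
Proof. by move=> /negPf gf; rewrite /tail ffunE gf; case: eqP. Qed.

Lemma head_reverse_cut O X e :
  head (reverse_cut O X) e = if e \in cut X then tail O e else head O e.
Proof. by rewrite /head /tail ffunE; case: ifP => //; case: (O e) => //= b. Qed.

Lemma in_cut X e b : (e \in cut X) = ((endpt e b \in X) != (endpt e (~~ b) \in X)).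
Proof. by rewrite inE; case: b => //=; rewrite eq_sym. Qed.

Lemma in_inner X e b :
  (e \in inner X) = (endpt e b \in X) && (endpt e (~~ b) \in X).
Proof.
rewrite inE; apply/forallP/andP => [H|[H1 H2] c]; first by split.
by case: b c H1 H2 => [] [].
Qed.

Lemma head_incident O e v : head O e = Some v -> incident e v.
Proof.
by rewrite /head; case: (O e) => //= b [<-]; apply/existsP; exists b.
Qed.

Lemma head_tail_endpt O e v : head O e = Some v ->
  exists b, [/\ O e = Some b, endpt e b = v & tail O e = Some (endpt e (~~ b))].
Proof. by rewrite /head /tail; case: (O e) => //= b [<-]; exists b. Qed.

(** * In-degrees, seen through weighted sums over heads *)

Definition head_weight (w : vertex G -> nat) O :=
  \sum_e oapp w 0 (head O e).

(** The edges [e] and [f] only exchange roles: one of them contributes [w v] and the other nothing,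
    before and after. *)
Lemma head_weight_pivot w O v e f :
  can_pivot O v e f -> head_weight w (pivot O v e f) = head_weight w O.
Proof.
move=> piv; have [ev fN _] := piv.
have fe : f != e.
  by apply/eqP => fe; move: ev; rewrite /head -fe fN.
have split O' : head_weight w O' =
    oapp w 0 (head O' e) + (oapp w 0 (head O' f) +
      \sum_(g | (g != e) && (g != f)) oapp w 0 (head O' g)).
  by rewrite /head_weight (bigD1 e) //= (bigD1 f).
rewrite !split !head_pivot // !eqxx (negPf fe) ev [head O f]/head fN /= !add0n.
congr (_ + _); apply: eq_bigr => g /andP[/negPf ge /negPf gf].
by rewrite head_pivot // ge gf.
Qed.

Lemma head_weight_le w O m :
  (forall v, w v <= m) -> head_weight w O <= #|edge G| * m.
Proof.
move=> wm; rewrite -sum_nat_const; apply: leq_sum => e _.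
by case: (head O e) => //= v.
Qed.

(** For the indicator function of [v], the head weight is the in-degree of [v]. *)
Lemma mem_sources O v :
  (v \in sources O) = (head_weight (fun u => u == v) O == 0).
Proof.
rewrite inE sum_nat_eq0; apply: eq_forallb => e /=.
by case: (head O e) => //= u; rewrite -[Some u == _]/(u == v); case: (u == v).
Qed.

Lemma eq_sources O O' : (forall w, head_weight w O = head_weight w O') ->
  sources O = sources O'.
Proof. by move=> eqw; apply/setP => v; rewrite !mem_sources eqw. Qed.

(** * Acyclicity of the burnt set *)

Definition burnt_ranked O X := exists r : vertex G -> nat,
  forall e u v, tail O e = Some u -> head O e = Some v -> v \in X ->
    u \in X /\ r u < r v.

Lemma burnt_ranked_sources O : burnt_ranked O (sources O).
Proof.
exists (fun=> 0) => e u v _ ev; rewrite inE => /forallP/(_ e).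
by rewrite ev eqxx.
Qed.

(** The only newly oriented edge has its head [v] outside [X], where nothing is required. *)
Lemma burnt_ranked_pivot O X v e f :
  dhar_can_pivot O X v e f -> burnt_ranked O X ->
  burnt_ranked (pivot O v e f) X.
Proof.
case=> piv vb _ _ [r rP]; exists r => g u u'.
have vX : v \notin X by move: vb; rewrite !inE => /andP[].
rewrite head_pivot //; case: (eqVneq g f) => [->|gf].
  by case: (f == e) => // _ [<-]; rewrite (negPf vX).
by rewrite tail_pivot //; case: (g == e) => //; apply: rP.
Qed.

Lemma burnt_ranked_add O X :
  burnt_ranked O X -> burnt_ranked O (X :|: dhar_new O X).
Proof.
(* All new vertices may share one rank [M] above the old ones: an arc into a new vertex is not inner
   to the complement of [X], so its tail lies in [X]. *)
case=> r rP; pose M := (\max_v r v).+1.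
exists (fun v => if v \in X then r v else M) => e u v eu ev.
rewrite inE; case: (boolP (v \in X)) => [vX _|vX /=].
  by have [uX ltuv] := rP e u v eu ev vX; rewrite inE uX.
rewrite inE => /andP[_ /forallP/(_ e)]; rewrite ev eqxx implybF => einn.
have uX : u \in X.
  have [b [Oe eb]] := head_tail_endpt ev; rewrite eu => -[ub].
  by move: einn; rewrite (in_inner _ _ b) eb -ub !inE vX negbK.
by rewrite inE uX ltnS leq_bigmax.
Qed.

(** When everything is burnt, the rank strictly increases along every arc, so going around a cycle
    would give [r x < r x]. *)
Lemma acyclic_burnt_ranked O : burnt_ranked O setT -> acyclic O.
Proof.
move=> [r rP] [[|x p] [] // _ /andP[cyc _]].
have arcr : subrel (arc O) (relpre r ltn).
  move=> u v /existsP[e /andP[/eqP eu /eqP ev]].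
  by case: (rP e u v eu ev _); rewrite ?inE.
have tr : transitive (relpre r ltn) by move=> a b c; apply: ltn_trans.
move: cyc => /= /(sub_path arcr)/(order_path_min tr)/allP/(_ x).
by rewrite mem_rcons mem_head /= ltnn => /(_ isT).
Qed.

(** * The cut at which Dhar's algorithm stops *)

Lemma inner_edge_not_new O X v :
  dhar_new O X = set0 -> v \in boundary (~: X) ->
  exists2 e, e \in inner (~: X) & head O e = Some v.
Proof.
move=> new0 vb; have := in_set0 v; rewrite -new0 inE vb /=.
move=> /negbT/forallPn[e]; rewrite negb_imply negbK => /andP[einn /eqP ev].
by exists e.
Qed.

(** Each end of a cut edge outside [X] also has an incoming inner edge. An unoriented cut edge would
    therefore allow a pivot, and one directed into [X] contradicts the ranking. *)
Lemma dhar_cut_directed_out O X :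
  burnt_ranked O X -> dhar_pivots_done O X -> dhar_new O X = set0 ->
  cut_directed_out O X.
Proof.
move=> [r rP] done new0 e ecut.
have cutC : cut (~: X) = cut X.
  by apply/setP => g; rewrite !inE; do 2!case: (_ \in X).
have [b [bX nbX]] : exists b, endpt e b \notin X /\ endpt e (~~ b) \in X.
  move: ecut; rewrite inE.
  case X0: (endpt e false \in X); case X1: (endpt e true \in X) => //= _.
    by exists true; rewrite X1.
  by exists false; rewrite X0.
have vb : endpt e b \in boundary (~: X).
  rewrite 2!inE bX /=; apply/existsP; exists e; rewrite cutC ecut /=.
  by apply/existsP; exists b.
have [g ginn gv] := inner_edge_not_new new0 vb.
case Oe: (O e) => [c|]; last first.
  case: (done (endpt e b) g e); split=> //; split=> //.
  by apply/existsP; exists b.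
case: (eqVneq c b) => [cb|cb].
  by exists (endpt e b); rewrite ?inE // /head Oe cb.
have {}cb : c = ~~ b by case: c b cb {Oe bX nbX vb gv} => [] [].
have := rP e (endpt e b) (endpt e c).
rewrite /head /tail Oe cb /= negbK => /(_ erefl erefl nbX) [].
by rewrite (negPf bX).
Qed.

(** A vertex that loses an incoming edge lies on the boundary of the complement of [X]; it keeps an
    incoming inner edge, which the reversal does not touch. *)
Lemma sources_reverse_cut O X :
  dhar_new O X = set0 -> cut_directed_out O X ->
  sources (reverse_cut O X) \subset sources O.
Proof.
move=> new0 out; apply/subsetP => v; rewrite !inE => /forallP noin.
apply/forallP => e; apply/eqP => ev.
have [ecut|ecut] := boolP (e \in cut X); last first.
  by have := noin e; rewrite head_reverse_cut (negPf ecut) ev eqxx.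
have vX : v \in ~: X by have [u uX] := out e ecut; rewrite ev => -[->].
have [g ginn gv] : exists2 g, g \in inner (~: X) & head O g = Some v.
  apply: inner_edge_not_new new0 _; rewrite inE vX; apply/existsP; exists e.
  rewrite (head_incident ev) andbT; move: ecut; rewrite !inE.
  by do 2!case: (_ \in X).
have := noin g; rewrite head_reverse_cut gv.
suff /negPf-> : g \notin cut X by rewrite eqxx.
move: ginn; rewrite (in_inner _ _ true) !inE => /andP[/negPf-> /negPf-> //].
Qed.

(** * Weight gained by reversing a cut *)

Definition dominating (s : vertex G) (w : vertex G -> nat) :=
  forall Y : {set vertex G}, Y != set0 -> s \notin Y ->
    exists u y, [/\ u \notin Y, y \in Y, adjacent u y &
                 forall z, z \in Y -> #|edge G| * w z < w u].

Lemma head_weight_reverse_cut s w O X :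
  dominating s w -> s \in X -> X != setT -> cut_directed_out O X ->
  head_weight w O < head_weight w (reverse_cut O X).
Proof.
move=> dom sX XT out.
have Y0 : ~: X != set0 by rewrite -setCT (inj_eq (@setC_inj _)).
have sY : s \notin ~: X by rewrite inE sX.
have [u [y [uY yY /existsP[e /existsP[b /andP[/eqP eu /eqP ey]]] wu]]] := dom _ Y0 sY.
rewrite inE negbK in uY.
have ecut : e \in cut X.
  by rewrite (in_cut _ _ b) eu ey uY; move: yY; rewrite inE => /negPf->.
have etail : tail O e = Some u.
  have [v vY ev] := out e ecut; have [c [Oe ec ->]] := head_tail_endpt ev.
  case: (eqVneq c b) => [cb|cb]; last by case: c b cb eu {Oe ec ey} => [] [] //= _ ->.
  by move: vY; rewrite -ec cb eu inE uY.
rewrite /head_weight !(bigID (mem (cut X)) xpredT) /=.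
have -> : \sum_(i | i \notin cut X) oapp w 0 (head (reverse_cut O X) i)
        = \sum_(i | i \notin cut X) oapp w 0 (head O i).
  by apply: eq_bigr => g /negPf gcut; rewrite head_reverse_cut gcut.
rewrite ltn_add2r.
(* After the reversal [e] alone contributes [w u]. Before it, at most [#|edge G|] cut edges
   contribute at most [m] each, which is the reason for the factor in [dominating]. *)
apply: (@leq_trans (w u)); last first.
  by rewrite (bigD1 e) //= head_reverse_cut ecut etail leq_addr.
pose m := \max_(z in ~: X) w z.
apply: (@leq_ltn_trans (#|edge G| * m)).
  apply: (@leq_trans (\sum_(g in cut X) m)).
    apply: leq_sum => g /out[v vY ->] /=.
    exact: (@leq_bigmax_cond _ (fun z => z \in ~: X) w v vY).
  by rewrite sum_nat_const leq_mul2r max_card orbT.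
have /(eq_bigmax_cond w)[z zY mz] : 0 < #|~: X| by rewrite card_gt0.
by rewrite /m mz wu.
Qed.

(** * Invariant and termination of a single Dhar run *)

Definition dhar_inv O0 O X :=
  [/\ forall w, head_weight w O = head_weight w O0, sources O0 \subset X,
      burnt_ranked O X & equivalent O0 O].

Lemma dhar_inv_init O : dhar_inv O O (sources O).
Proof. by split=> //; [exact: burnt_ranked_sources | exact: rt_refl]. Qed.

Lemma dhar_inv_pivot O0 O X v e f :
  dhar_can_pivot O X v e f -> dhar_inv O0 O X ->
  dhar_inv O0 (pivot O v e f) X.
Proof.
move=> piv [wO sX rk eqv]; have [cp _ _ _] := piv; split=> //.
- by move=> w; rewrite head_weight_pivot.
- exact: burnt_ranked_pivot.
- by apply: rt_trans eqv _; apply: rt_step; apply: MovePivot.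
Qed.

Lemma dhar_inv_add O0 O X :
  dhar_inv O0 O X -> dhar_inv O0 O (X :|: dhar_new O X).
Proof.
move=> [wO sX rk eqv]; split=> //; last exact: burnt_ranked_add.
exact: subset_trans sX (subsetUl _ _).
Qed.

Lemma acc_output O : terminates (Output O).
Proof. by constructor => s st; inversion st. Qed.

(** Lexicographic order on the number of unburnt vertices, then of unoriented cut edges. The second
    count is at most [#|edge G|], hence the base [#|edge G|.+1]. *)
Definition dhar_measure O X :=
  #|~: X| * #|edge G|.+1 + #|[set e in cut X | O e == None]|.

Lemma dhar_measure_pivot O X v e f : dhar_can_pivot O X v e f ->
  dhar_measure (pivot O v e f) X < dhar_measure O X.
Proof.
case=> -[ev fN fv] vb einn fcut; rewrite ltn_add2l; apply: proper_card.
apply/properP; split.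
  apply/subsetP => g; rewrite !inE ffunE => /andP[gcut]; rewrite gcut.
  case: (eqVneq g e) gcut => [->|_ _]; last by case: ifP.
  move: einn; rewrite (in_inner _ _ true) !inE => /andP[/negPf-> /negPf-> //].
exists f; first by rewrite inE fcut fN eqxx.
rewrite inE ffunE fcut eqxx; case: (eqVneq f e) => // fe.
by move: ev; rewrite /head -fe fN.
Qed.

Lemma dhar_measure_add O X : dhar_new O X <> set0 ->
  dhar_measure O (X :|: dhar_new O X) < dhar_measure O X.
Proof.
move=> /eqP/set0Pn[v vnew].
have ltC : #|~: (X :|: dhar_new O X)| < #|~: X|.
  apply: proper_card; apply/properP; split; first by rewrite setCS subsetUl.
  exists v; last by rewrite in_setC in_setU vnew orbT.
  by move: vnew; rewrite !inE => /andP[/andP[]].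
apply: leq_trans (leq_addr _ _); apply: leq_trans (leq_mul ltC (leqnn _)).
by rewrite mulSn /dhar_measure addnC ltn_add2r ltnS max_card.
Qed.

(** Pivots and additions decrease the measure; the reversal that leaves the run is left as a
    hypothesis, to be supplied by the outer induction. *)
Lemma dhar_terminates O0 :
  (forall O X, dhar_inv O0 O X -> dhar_new O X = set0 -> X <> setT ->
     cut_directed_out O X -> terminates (Outer (reverse_cut O X))) ->
  forall O X, dhar_inv O0 O X -> terminates (Dhar O X).
Proof.
move=> rev O X; have [n] := ubnP (dhar_measure O X).
elim: n O X => [|n IHn] O X; first by rewrite ltn0.
rewrite ltnS => le_n inv.
constructor=> s st; inversion st; subst.
- apply: IHn; last exact: dhar_inv_pivot.
  exact: leq_trans (dhar_measure_pivot _) le_n.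
- apply: IHn; last exact: dhar_inv_add.
  exact: leq_trans (dhar_measure_add _) le_n.
- exact: acc_output.
- exact: rev.
Qed.

Lemma unfurling_terminates O : connected G -> terminates (Outer O).
Proof.
move=> conn; have [n] := ubnP #|sources O|.
elim: n O => [|n IHn] O0; first by rewrite ltn0.
rewrite ltnS => le_n.
have [S0|/set0Pn[s sS]] := eqVneq (sources O0) set0.
  constructor=> t st; inversion st as [? _|? nS0| | | |]; subst.
    exact: acc_output.
  by case: (nS0 S0).
have [w dom] : exists w, dominating s w.
  exact: connect_dominating_weight (conn s).
pose bound := #|edge G| * \max_v w v.
have [m] := ubnP (bound - head_weight w O0).
(* Here [s] and [w] stay fixed while [O0] varies, so the weights of successive orientations are
   comparable as long as [s] remains a source. *)
elim: m O0 le_n sS => [|m IHm] O0 le_n sS; first by rewrite ltn0.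
rewrite ltnS => le_m.
constructor=> t st; inversion st; subst; first exact: acc_output.
apply: dhar_terminates (dhar_inv_init O0) => O X [wO sX _ _] new0 /eqP XT out.
(* The orientation [O] just before the reversal has the sources of [O0], since pivots preserve
   in-degrees. *)
have sub := sources_reverse_cut new0 out; rewrite (eq_sources wO) in sub.
have [eqS|neqS] := eqVneq (sources (reverse_cut O X)) (sources O0); last first.
  apply: IHn; apply: leq_trans le_n; apply: proper_card.
  by rewrite properEneq neqS.
apply: IHm; rewrite ?eqS //; apply: leq_trans le_m.
have := head_weight_reverse_cut dom (subsetP sX s sS) XT out.
rewrite wO => lt_w.
have : head_weight w (reverse_cut O X) <= bound.
  by apply: head_weight_le => v; apply: leq_bigmax.
lia.
Qed.

(** * Correctness of the output *)

Definition run_inv O0 (s : state G) :=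
  match s with
  | Outer O1 => equivalent O0 O1
  | Dhar O1 X => exists2 O2, equivalent O0 O2 & dhar_inv O2 O1 X
  | Output O1 => equivalent O0 O1 /\ (acyclic O1 \/ sourceless O1)
  end.

Lemma run_inv_step O0 s t : step s t -> run_inv O0 s -> run_inv O0 t.
Proof.
case=> {s t}; rewrite /run_inv.
- by move=> O S0 eqv; split=> //; right.
- by move=> O _ eqv; exists O => //; apply: dhar_inv_init.
- move=> O X v e f piv [O1 eqv inv]; exists O1 => //.
  exact: dhar_inv_pivot.
- by move=> O X _ _ [O1 eqv inv]; exists O1 => //; apply: dhar_inv_add.
- move=> O X _ _ -> [O1 eqv [_ _ rk eqv1]]; split; first exact: rt_trans eqv eqv1.
  by left; apply: acyclic_burnt_ranked.
- move=> O X _ _ _ out [O1 eqv [_ _ _ eqv1]].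
  apply: rt_trans eqv (rt_trans _ _ _ _ _ eqv1 _).
  by apply: rt_step; apply: MoveReversal; left.
Qed.

Lemma run_inv_reachable O0 s : reachable (Outer O0) s -> run_inv O0 s.
Proof.
have main a b : reachable a b -> run_inv O0 a -> run_inv O0 b.
  elim=> {a b} [a b st|//|a b c _ ab _ bc ia]; first exact: run_inv_step st.
  exact: bc (ab ia).
by move=> /main; apply; apply: rt_refl.
Qed.

(** Every other state has a successor. The delicate case is [StepReverse], whose premise on the cut
    must be derived from the ranking of the burnt set. *)
Lemma run_inv_final O0 s : run_inv O0 s -> final s -> exists O, s = Output O.
Proof.
case: s => [O _ fin|O X [O1 _ [_ _ rk _]] fin|O _ _]; last by exists O.
  have [S0|/eqP S0] := eqVneq (sources O) set0.
    by case: (fin (Output O)); apply: StepSourceless.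
  by case: (fin (Dhar O (sources O))); apply: StepInit.
have done : dhar_pivots_done O X.
  by move=> v e f piv; case: (fin (Dhar (pivot O v e f) X)); apply: StepPivot.
have [new0|/eqP newN] := eqVneq (dhar_new O X) set0; last first.
  by case: (fin (Dhar O (X :|: dhar_new O X))); apply: StepAdd.
have [XT|/eqP XT] := eqVneq X setT.
  by case: (fin (Output O)); apply: StepFull XT.
case: (fin (Outer (reverse_cut O X))); apply: StepReverse => //.
exact: dhar_cut_directed_out.
Qed.

End Unfurling.

Theorem mainTheorem5 (G : multigraph) (O : orientation G) :
  connected G ->
  has_dicycle O ->
  ~ sourceless O ->
  terminates (Outer O) /\
  (forall s : state G, reachable (Outer O) s -> final s ->
     exists O' : orientation G,
       [/\ s = Output O', equivalent O O' & acyclic O' \/ sourceless O']).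
Proof.
move=> conn _ _; split; first exact: unfurling_terminates.
move=> s /run_inv_reachable inv fin; have [O' sO'] := run_inv_final inv fin.
by rewrite sO' /= in inv; case: inv => eqv alt; exists O'.
Qed.
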